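(* Let $f\colon\mathbb{R}^n\to\mathbb{R}\cup\{+\infty\}$ be a lower semi-continuous semi-algebraic function and let $S\subset\mathbb{R}^n$ be a closed semi-algebraic set such that $\mathrm{dom} f\cap S$ is nonempty and unbounded. Assume that the qualification condition at infinity $(\mathrm{QC})_\infty$ holds. Then $f$ is bounded from below on $S$ if and only if for any $k\in K$, $$\alpha_k>0\quad\Longrightarrow\quad a_k>0.$$
   Context: Conventions. $\|\cdot\|$ is the Euclidean norm on $\mathbb{R}^n$; $\mathbb{B}_R$ and $\mathbb{S}_R$ are the closed ball and the sphere of radius $R>0$ centered at $0$. A subset of $\mathbb{R}^n$ is semi-algebraic if it is a finite union of sets, each defined by finitely many polynomial equalities and strict inequalities; a map is semi-algebraic if its graph is (for $f\colon\mathbb{R}^n\to\mathbb{R}\cup\{+\infty\}$ the graph is $\{(x,y)\in\mathbb{R}^n\times\mathbb{R}\mid y=f(x)\}$). $\mathrm{dom} f=\{x\mid f(x)<+\infty\}$, $\mathrm{epi} f=\{(x,\alpha)\in\mathbb{R}^n\times\mathbb{R}\mid f(x)\le\alpha\}$. Normals and subdifferentials. For $x\in S\subset\mathbb{R}^n$, the regular normal cone $\widehat N(x;S)$ is the set of $v$ with $\langle v,x'-x\rangle\le o(\|x'-x\|)$ as $x'\to x$, $x'\in S$. The limiting normal cone $N(x;S)$ is the set of $v$ for which there are $x_k\to x$, $x_k\in S$, and $v_k\to v$ with $v_k\in\widehat N(x_k;S)$. For $x\in\mathrm{dom} f$: $\partial f(x)=\{v\mid (v,-1)\in N((x,f(x));\mathrm{epi}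 f)\}$ and $\partial^\infty f(x)=\{v\mid (v,0)\in N((x,f(x));\mathrm{epi} f)\}$. $(\mathrm{QC})_\infty$: there exists $R>0$ such that $\partial^\infty f(x)\cap(-N(x;S))=\{0\}$ for all $x\in(\mathrm{dom} f\cap S)\setminus\mathbb{B}_R$. Tangency variety: $\Gamma(f,S)=\{x\in\mathrm{dom} f\cap S\mid \exists\mu\in\mathbb{R}:\ 0\in\partial f(x)+N(x;S)+\mu x\}$ (a semi-algebraic set). Decomposition at infinity. Fix a finite partition of $\Gamma(f,S)$ into semi-algebraic sets $C_1,\ldots,C_\ell$ on each of which $f$ is continuous. By Hardt's triviality theorem applied to $x\mapsto\|x\|$ on $\Gamma(f,S)$, there are $R>0$, semi-algebraic sets $F_1,\ldots,F_\ell$ and a semi-algebraic homeomorphism $h\colon(\cup_i F_i)\times(R,+\infty)\to\Gamma(f,S)\setminus\mathbb{B}_R$ with $\|h(x,t)\|=t$ and $h(F_i\times(R,+\infty))=C_i\setminus\mathbb{B}_R$ for all $i$. Let $\Gamma_1,\ldots,\Gamma_p$ be the sets $h(F'\times(R,+\infty))$, with $F'$ running over the connected components of $F_1,\ldots,F_\ell$. Thus $\Gamma(f,S)\setminus\mathbb{B}_R$ is the disjoint union of the semi-algebraic sets $\Gamma_k$; each $\Gamma_k$ is connected and unbounded, $\Gamma_k\cap\mathbb{S}_t$ is nonempty and connected for each $t>R$, and $f|_{\Gamma_k}$ is continuous. $R$ may be increased to $R'$ by restricting $h$, i.e. replacing $\Gamma_k$ by $\Gamma_k\setminus\mathbb{B}_{R'}$.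 Under $(\mathrm{QC})_\infty$, for $R$ large enough $f$ is constant on each $\Gamma_k\cap\mathbb{S}_t$, $t>R$, so $f_k\colon(R,+\infty)\to\mathbb{R}$, $f_k(t):=f(x)$ for any $x\in\Gamma_k\cap\mathbb{S}_t$, is well defined; it is semi-algebraic and, for $R$ large enough, either constant or strictly monotone. $R$ is fixed sufficiently large (the claim is for all sufficiently large $R$). $K:=\{k\in\{1,\ldots,p\}\mid f_k\text{ is not constant}\}$. For $k\in K$, by semi-algebraicity one can write $f_k(t)=a_kt^{\alpha_k}+{}$lower order terms in $t$ (i.e. $f_k(t)=a_kt^{\alpha_k}+o(t^{\alpha_k})$) as $t\to+\infty$, with $a_k\in\mathbb{R}\setminus\{0\}$ and $\alpha_k\in\mathbb{Q}$; this defines $a_k,\alpha_k$. *)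

(* Defs.v *)
From HB Require Import structures.
From mathcomp Require Import all_boot all_order all_algebra.
(* The notations of [mpoly] clash with those of the analysis library. *)
From mathcomp Require Import -(notations) mpoly.
From mathcomp Require Import all_classical all_reals all_analysis.

Set Implicit Arguments.
Unset Strict Implicit.
Unset Printing Implicit Defensive.

Import Order.TTheory GRing.Theory Num.Theory.
Import numFieldNormedType.Exports.

Local Open Scope classical_set_scope.
Local Open Scope ring_scope.

(** * Euclidean geometry of R^n

    The library norm on ['rV[R]_n] is the sup norm.  It induces the Euclidean
    topology, so library limits, continuity, closedness, connectedness and
    boundedness are used as they are; every distance that enters a definition
    is the Euclidean one below. *)

Definition dotp (R : realType) (n : nat) (u v : 'rV[R]_n) : R :=
  \sum_(i < n) u 0 i * v 0 i.

Definition enorm (R : realType) (n : nat) (x : 'rV[R]_n) : R :=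
  Num.sqrt (dotp x x).

Definition eball (R : realType) (n : nat) (r : R) : set 'rV[R]_n :=
  [set x | enorm x <= r].

Definition esphere (R : realType) (n : nat) (r : R) : set 'rV[R]_n :=
  [set x | enorm x = r].

(** A point [(x, y)] of [R^n * R] is encoded as a row vector of size [n + 1]. *)
Definition snoc (R : realType) (n : nat) (x : 'rV[R]_n) (y : R) :
  'rV[R]_(n + 1) := row_mx x (const_mx y).

Definition butlast (R : realType) (n : nat) (z : 'rV[R]_(n + 1)) : 'rV[R]_n :=
  lsubmx z.

Definition lastc (R : realType) (n : nat) (z : 'rV[R]_(n + 1)) : R :=
  rsubmx z 0 0.

(** * Semi-algebraic sets and maps *)

(** [c.1] lists the polynomials required to vanish, [c.2] those required to be
    positive. *)
Definition basic_semialg (R : realType) (m : nat)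
    (c : seq (mpoly m R) * seq (mpoly m R)) : set 'rV[R]_m :=
  [set x | (forall p, p \in c.1 -> meval (x 0) p = 0) /\
           (forall q, q \in c.2 -> 0 < meval (x 0) q)].

Definition semialgebraic (R : realType) (m : nat) (A : set 'rV[R]_m) : Prop :=
  exists L : seq (seq (mpoly m R) * seq (mpoly m R)),
    A = [set x | exists2 c, c \in L & basic_semialg c x].

Definition semialgebraic_map_on (R : realType) (m n : nat)
    (D : set 'rV[R]_m) (h : 'rV[R]_m -> 'rV[R]_n) : Prop :=
  semialgebraic
    [set z : 'rV[R]_(m + n) | D (lsubmx z) /\ rsubmx z = h (lsubmx z)].

(** The graph only contains the points [(x, y)] with [y] real. *)
Definition semialgebraic_efun (R : realType) (n : nat)
    (f : 'rV[R]_n -> \bar R) : Prop :=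
  semialgebraic [set z : 'rV[R]_(n + 1) | (lastc z)%:E = f (butlast z)].

(** * Normal cones and subdifferentials *)

Definition dom (R : realType) (n : nat) (f : 'rV[R]_n -> \bar R) :
  set 'rV[R]_n := [set x | (f x < +oo)%E].

Definition epi (R : realType) (n : nat) (f : 'rV[R]_n -> \bar R) :
  set 'rV[R]_(n + 1) := [set z | (f (butlast z) <= (lastc z)%:E)%E].

(** [<v, x' - x>] is bounded above by an [o(|x' - x|)]. *)
Definition regular_normal (R : realType) (n : nat) (S : set 'rV[R]_n)
    (x : 'rV[R]_n) : set 'rV[R]_n :=
  [set v | forall e : R, 0 < e -> \forall x' \near x,
     S x' -> dotp v (x' - x) <= e * enorm (x' - x)].

Definition limiting_normal (R : realType) (n : nat) (S : set 'rV[R]_n)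
    (x : 'rV[R]_n) : set 'rV[R]_n :=
  [set v | exists (x_ v_ : nat -> 'rV[R]_n),
     [/\ x_ @ \oo --> x, forall k, S (x_ k), v_ @ \oo --> v &
         forall k, regular_normal S (x_ k) (v_ k)]].

(** For [x] in [dom f] and [f] never [-oo], [fine (f x)] is the real [f x]. *)
Definition subdiff (R : realType) (n : nat) (f : 'rV[R]_n -> \bar R)
    (x : 'rV[R]_n) : set 'rV[R]_n :=
  [set v | limiting_normal (epi f) (snoc x (fine (f x))) (snoc v (- 1))].

Definition horizon_subdiff (R : realType) (n : nat) (f : 'rV[R]_n -> \bar R)
    (x : 'rV[R]_n) : set 'rV[R]_n :=
  [set v | limiting_normal (epi f) (snoc x (fine (f x))) (snoc v 0)].

Definition QC_infty (R : realType) (n : nat) (f : 'rV[R]_n -> \bar R)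
    (S : set 'rV[R]_n) : Prop :=
  exists2 r : R, 0 < r & forall x, ((dom f `&` S) `\` eball r) x ->
    horizon_subdiff f x `&` [set - w | w in limiting_normal S x] = [set 0].

Definition tangency (R : realType) (n : nat) (f : 'rV[R]_n -> \bar R)
    (S : set 'rV[R]_n) : set 'rV[R]_n :=
  [set x | (dom f `&` S) x /\ exists (mu : R) (v w : 'rV[R]_n),
     [/\ subdiff f x v, limiting_normal S x w & 0 = v + w + mu *: x]].

(** * Decomposition at infinity of the tangency variety *)

Definition homeomorphism_on (X Y : topologicalType) (A : set X) (B : set Y)
    (h : X -> Y) : Prop :=
  [/\ set_bij A B h, {within A, continuous h} &
      exists2 g : Y -> X, (forall x, A x -> g (h x) = x) &
                          {within B, continuous g}].

(** [A * ]r, +oo[], as a set of row vectors. *)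
Definition cylinder (R : realType) (m : nat) (A : set 'rV[R]_m) (r : R) :
  set 'rV[R]_(m + 1) := [set z | A (butlast z) /\ r < lastc z].

Definition admissible_partition (R : realType) (n l : nat)
    (f : 'rV[R]_n -> \bar R) (S : set 'rV[R]_n)
    (C : 'I_l -> set 'rV[R]_n) : Prop :=
  [/\ partition [set: 'I_l] C (tangency f S),
      forall i, semialgebraic (C i) &
      forall i, {within C i, continuous f}].

(** The trivialization over [ ]r, +oo[ ] of the Euclidean norm on [G],
    compatible with the pieces [C i], as provided by Hardt's theorem. *)
Definition hardt_trivialization (R : realType) (n l m : nat)
    (G : set 'rV[R]_n) (C : 'I_l -> set 'rV[R]_n) (r : R)
    (F : 'I_l -> set 'rV[R]_m) (h : 'rV[R]_(m + 1) -> 'rV[R]_n) : Prop :=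
  let D := cylinder (\bigcup_i F i) r in
  [/\ 0 < r,
      forall i, semialgebraic (F i),
      semialgebraic_map_on D h /\ homeomorphism_on D (G `\` eball r) h,
      forall z, D z -> enorm (h z) = lastc z &
      forall i, h @` cylinder (F i) r = C i `\` eball r].

Definition components (X : topologicalType) (I : Type) (F : I -> set X) :
  set (set X) :=
  [set E | exists i, exists2 x, F i x & E = connected_component (F i) x].

(** [E] enumerates without repetition the connected components of the [F i]. *)
Definition enumerates_components (R : realType) (l m p : nat)
    (F : 'I_l -> set 'rV[R]_m) (E : 'I_p -> set 'rV[R]_m) : Prop :=
  set_bij [set: 'I_p] (components F) E.

(** The pieces [Gamma_k] over [ ]r, +oo[ ]. *)
Definition piece (R : realType) (n m p : nat)
    (h : 'rV[R]_(m + 1) -> 'rV[R]_n) (E : 'I_p -> set 'rV[R]_m) (r : R)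
    (k : 'I_p) : set 'rV[R]_n := h @` cylinder (E k) r.

(** [fk k t] is the value of [f] at any point of [Gamma_k] of norm [t]. *)
Definition radial_values (R : realType) (n p : nat) (f : 'rV[R]_n -> \bar R)
    (Gamma : 'I_p -> set 'rV[R]_n) (r : R) (fk : 'I_p -> R -> R) : Prop :=
  forall k t, r < t ->
    forall x, (Gamma k `&` esphere t) x -> f x = (fk k t)%:E.

Definition nonconstant (R : realType) (p : nat) (fk : 'I_p -> R -> R) (r : R) :
  set 'I_p := [set k | ~ exists c, forall t, r < t -> fk k t = c].

(** [g t = a * t ^ alpha + o(t ^ alpha)] as [t] tends to [+oo]; the [o] is
    written out because [landau] has no filter structure on [+oo]. *)
Definition leading_term (R : realType) (g : R -> R) (a : R) (alpha : rat) :
  Prop :=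
  a != 0 /\
  forall e : R, 0 < e -> \forall t \near +oo%R,
    `|g t - a * t `^ ratr alpha| <= e * `|t `^ ratr alpha|.

Definition bounded_below_on (R : realType) (n : nat) (f : 'rV[R]_n -> \bar R)
    (S : set 'rV[R]_n) : Prop :=
  exists M : R, forall x, S x -> (M%:E <= f x)%E.

(* Main.v *)
Require Import Defs.
From HB Require Import structures.
From mathcomp Require Import all_boot all_order all_algebra.
From mathcomp Require Import -(notations) mpoly.
From mathcomp Require Import all_classical all_reals all_analysis.
From mathcomp Require Import ring lra.

Set Implicit Arguments.
Unset Strict Implicit.
Unset Printing Implicit Defensive.

Import Order.TTheory GRing.Theory Num.Theory.
Import numFieldNormedType.Exports.

Local Open Scope classical_set_scope.
Local Open Scope ring_scope.

(** If [f] is bounded below on [S], then no [f_k] can tend to [-oo], because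
    each piece meets every large sphere; this rules out a positive exponent
    with a negative coefficient.

    The converse rests on [tangency_point_below]: if [f] is unbounded below on
    [S], then the tangency variety contains points of arbitrarily large norm at
    which [f] is arbitrarily negative.  Finitely many pieces cover the tangency
    variety near infinity, so some [f_k] is then unbounded below near infinity,
    which the sign condition forbids by [leading_term_bounded_below].

    The tangency points do not come from minimizing [f] on spheres, which would
    require the sphere to be transverse to [f] and [S], but from a smooth radial
    penalty.  Start from [x0] in [S] where [f] is very negative, lower than
    anywhere on the part of [S] in a large ball.  Minimize
    [f x + k * (|x|^2 - |x0|^2)^2] over the points of [S] with
    [|x|^2 <= |x0|^2 + 1].  For [k] large the minimizer is in the interior of
    this constraint; its value is at most [f x0], so it lies outside the large
    ball.  The gradient of the penalty at [x] is a multiple of [x], so the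
    first-order condition [0 \in subdiff f x + N (x; S) + mu x] is precisely
    membership in the tangency variety.

    That first-order condition is a sum rule for limiting subdifferentials, and
    the qualification condition at [x] is what makes it valid.  It is obtained
    in a Fritz John form ([fritz_john]) by decoupling: the variable of [f] and
    the variable of [S] are separated and their distance is penalized.  The
    penalized minimizers satisfy exact first-order conditions with opposite
    multipliers; after normalization these multipliers accumulate, and the
    qualification condition says that the multiplier of [f] does not vanish in
    the limit ([local_min_tangency]). *)

(** * The Euclidean inner product *)

Section InnerProduct.
Variables (R : realType) (n : nat).
Implicit Types u v w x : 'rV[R]_n.

Lemma dotpC u v : dotp u v = dotp v u.
Proof. by apply: eq_bigr => i _; rewrite mulrC. Qed.

Lemma dotpDl u v w : dotp (u + v) w = dotp u w + dotp v w.
Proof. by rewrite -big_split; apply: eq_bigr => i _; rewrite mxE mulrDl. Qed.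

Lemma dotpZl a u v : dotp (a *: u) v = a * dotp u v.
Proof. by rewrite mulr_sumr; apply: eq_bigr => i _; rewrite mxE mulrA. Qed.

Lemma dotpNl u v : dotp (- u) v = - dotp u v.
Proof. by rewrite -scaleN1r dotpZl mulN1r. Qed.

Lemma dotpDr u v w : dotp w (u + v) = dotp w u + dotp w v.
Proof. by rewrite dotpC dotpDl !(dotpC w). Qed.

Lemma dotpZr a u v : dotp u (a *: v) = a * dotp u v.
Proof. by rewrite dotpC dotpZl dotpC. Qed.

Lemma dotpNr u v : dotp u (- v) = - dotp u v.
Proof. by rewrite dotpC dotpNl dotpC. Qed.

Lemma dotp0l u : dotp 0 u = 0.
Proof. by rewrite -(scale0r 0) dotpZl mul0r. Qed.

Lemma dotp0r u : dotp u 0 = 0.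
Proof. by rewrite dotpC dotp0l. Qed.

Definition dotpE := (dotpDl, dotpDr, dotpNl, dotpNr, dotpZl, dotpZr).

Lemma dotp_ge0 u : 0 <= dotp u u.
Proof. by apply: sumr_ge0 => i _; rewrite -expr2 sqr_ge0. Qed.

Lemma dotp_eq0 u : dotp u u = 0 -> u = 0.
Proof.
move=> /eqP; rewrite psumr_eq0 => [/allP u0|i _]; last by rewrite -expr2 sqr_ge0.
apply/rowP => i; rewrite mxE; apply/eqP.
by have := u0 i (mem_index_enum i); rewrite -expr2 sqrf_eq0.
Qed.

Lemma cauchy_schwarz u v : dotp u v ^+ 2 <= dotp u u * dotp v v.
Proof.
have [v0|v_gt0] : dotp v v = 0 \/ 0 < dotp v v.
- by have := dotp_ge0 v; rewrite le_eqVlt => /orP[/eqP|]; [left|right].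
- by rewrite (dotp_eq0 v0) !dotp0r mulr0 expr0n.
(* This vector is [dotp v v] times the component of [u] orthogonal to [v]. *)
have := dotp_ge0 (dotp v v *: u - dotp u v *: v).
rewrite !dotpE (dotpC v u); move: v_gt0.
set a := dotp v v; set b := dotp u v; set c := dotp u u => a0.
rewrite [X in 0 <= X -> _](_ : _ = a * (c * a - b ^+ 2)); last by ring.
by rewrite pmulr_rge0 // subr_ge0.
Qed.

Lemma enorm_ge0 u : 0 <= enorm u. Proof. exact: sqrtr_ge0. Qed.

Lemma enorm_sqr u : enorm u ^+ 2 = dotp u u.
Proof. by rewrite sqr_sqrtr ?dotp_ge0. Qed.

Lemma enorm_le (r : R) u : 0 <= r -> (enorm u <= r) = (dotp u u <= r ^+ 2).
Proof. by move=> r0; rewrite -enorm_sqr ler_pXn2r ?nnegrE ?enorm_ge0. Qed.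

(** Hence Euclidean balls are bounded for the norm that carries the topology. *)
Lemma normr_le_enorm u : `|u| <= enorm u.
Proof.
rewrite [leLHS]/Num.norm /= mx_normrE; apply/bigmax_leP; split=> [|[i j] _ /=].
  exact: enorm_ge0.
rewrite ord1 -(ler_pXn2r (ltn0Sn 1)) ?nnegrE ?enorm_ge0 // enorm_sqr.
rewrite real_normK ?num_real // /dotp (bigD1 j) //= -expr2 lerDl.
by apply: sumr_ge0 => k _; rewrite -expr2 sqr_ge0.
Qed.

Lemma continuous_dotp (T : topologicalType) (g k : T -> 'rV[R]_n) :
  continuous g -> continuous k -> continuous (fun t => dotp (g t) (k t)).
Proof.
move=> gc kc t; rewrite /dotp.
have coord (q : T -> 'rV[R]_n) i : continuous q -> continuous (fun t => q t 0 i).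
  move=> qc s; apply: (@continuous_comp _ _ _ q (fun x : 'rV[R]_n => x 0 i)).
    exact: qc.
  exact: coord_continuous.
apply: cvg_big => [|i _]; first exact: add_continuous.
by apply: cvgM; [exact: (coord g) | exact: (coord k)].
Qed.
End InnerProduct.

(** * Minimization of lower semicontinuous functions *)

(** A cluster point that keeps track of the indices: it serves in place of the
    extraction of a convergent subsequence. *)
Lemma compact_seq_cluster (T : topologicalType) (K : set T) (u : nat -> T) :
  compact K -> (forall k, K (u k)) ->
  exists2 x, K x & forall V, nbhs x V -> forall N, exists2 k, (N <= k)%N & V (u k).
Proof.
move=> cK Ku; have [|x [Kx clx]] := cK (u @ \oo) _.
  by exists 0%N => // k _; exact: Ku.
exists x => // V xV N.
have [|y [[k Nk <-] Vy]] := clx [set u k | k in [set k | (N <= k)%N]] V _ xV.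
  by exists N => // k Nk; exists k.
by exists k.
Qed.

Lemma ereal_dense (R : realType) (x y : \bar R) :
  (x < y)%E -> exists2 a : R, (x < a%:E)%E & (a%:E < y)%E.
Proof.
case: x y => [x| |] [y| |] //=.
- rewrite lte_fin => xy; exists ((x + y) / 2); rewrite lte_fin; lra.
- by move=> _; exists (x + 1); rewrite ?ltry // lte_fin; lra.
- by move=> _; exists (y - 1); rewrite ?ltNyr // lte_fin; lra.
- by move=> _; exists 0; rewrite ?ltNyr ?ltry.
Qed.

(** If the infimum were not attained, the strict sublevel sets above it would
    form a filter base on [K]; lower semicontinuity at a cluster point, whose
    value exceeds some such level, contradicts this. *)
Lemma lsc_min (T : topologicalType) (R : realType) (K : set T)
    (F : T -> \bar R) :
  compact K -> K !=set0 -> lower_semicontinuous F ->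
  exists2 x, K x & forall y, K y -> (F x <= F y)%E.
Proof.
move=> cK [x0 Kx0] lF; apply: contrapT => nomin.
have lb x : K x -> exists2 a : R, (ereal_inf (F @` K) < a%:E)%E & (a%:E < F x)%E.
  move=> Kx; apply: ereal_dense; rewrite ltNge; apply/negP => Fx_le.
  apply: nomin; exists x => // y Ky; apply: le_trans Fx_le _.
  by apply: ereal_inf_lbound; exists y.
pose B (a : R) := [set x | K x /\ (F x < a%:E)%E].
pose G := filter_from [set a : R | (ereal_inf (F @` K) < a%:E)%E] B.
have PG : ProperFilter G.
  apply: filter_from_proper; last first.
    by move=> a /ereal_inf_lt[_ [x Kx <-] Fxa]; exists x.
  apply: filter_from_filter; first by have [a] := lb _ Kx0; exists a.
  move=> a b Ga Gb; exists (Num.min a b); first by rewrite /= minEle; case: ifP.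
  by move=> x [Kx]; rewrite EFin_min lt_min => /andP[].
have [|x [Kx clx]] := cK G PG.
  by have [a Ga _] := lb _ Kx0; exists a => // x [].
have [a Ga aFx] := lb _ Kx; have [V xV VF] := lF _ _ aFx.
have [|y [[_ Fya] /VF]] := clx (B a) V _ xV; first by exists a.
by rewrite ltNge (ltW Fya).
Qed.

Lemma lscD (T : topologicalType) (R : realType) (F : T -> \bar R) (g : T -> R) :
  lower_semicontinuous F -> continuous g ->
  lower_semicontinuous (fun x => F x + (g x)%:E)%E.
Proof.
move=> lF gc x a.
rewrite -lteBlDr // => aFx.
have [b ab bF] : exists2 b : R, a - g x < b & (b%:E < F x)%E.
  by have [b ab bF] := ereal_dense aFx; exists b.
have [V xV VF] := lF _ _ bF.
exists (V `&` [set y | a - b < g y]).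
  apply: filterI => //.
  have gx : nbhs (g x) [set b' | a - b < b'] by apply: lt_nbhsr; lra.
  exact: gc x _ gx.
move=> y [/VF by_ /= gy].
rewrite -lteBlDr // (le_lt_trans _ by_) // -EFinB lee_fin; lra.
Qed.

Lemma lsc_continuous (T : topologicalType) (R : realType) (g : T -> R) :
  continuous g -> lower_semicontinuous (fun x => (g x)%:E).
Proof.
move=> gc x a; rewrite lte_fin => ag; exists [set y | a < g y].
  have gx : nbhs (g x) [set b | a < b] by apply: lt_nbhsr.
  exact: gc x _ gx.
by move=> y; rewrite lte_fin.
Qed.

Lemma compact_argmin (T : topologicalType) (R : realType) (K : set T)
    (g : T -> R) :
  compact K -> K !=set0 -> continuous g ->
  exists2 x, K x & forall y, K y -> g x <= g y.
Proof.
move=> cK K0 gc; have [x Kx xmin] := lsc_min cK K0 (lsc_continuous gc).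
by exists x => // y /xmin; rewrite lee_fin.
Qed.

(** * Topology of row vectors *)

Lemma continuous_add (R : realType) (T : topologicalType) (V : normedModType R)
    (f g : T -> V) :
  continuous f -> continuous g -> continuous (fun t => f t + g t).
Proof. by move=> fc gc t; exact: (continuousD (fc t) (gc t)). Qed.

Lemma continuous_sub (R : realType) (T : topologicalType) (V : normedModType R)
    (f g : T -> V) :
  continuous f -> continuous g -> continuous (fun t => f t - g t).
Proof. by move=> fc gc t; exact: (continuousB (fc t) (gc t)). Qed.

Lemma continuous_mul (R : realType) (T : topologicalType) (f g : T -> R) :
  continuous f -> continuous g -> continuous (fun t => f t * g t).
Proof. by move=> fc gc t; exact: (continuousM (fc t) (gc t)). Qed.

Lemma continuous_scale (R : realType) (T : topologicalType) (V : normedModType R)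
    (k : T -> R) (g : T -> V) :
  continuous k -> continuous g -> continuous (fun t => k t *: g t).
Proof. by move=> kc gc t; exact: (continuousZ (kc t) (gc t)). Qed.

Lemma continuous_compose (T U V : topologicalType) (f : T -> U) (g : U -> V) :
  continuous f -> continuous g -> continuous (fun t => g (f t)).
Proof. by move=> fc gc t; exact: (continuous_comp (fc t) (gc _)). Qed.

Section Rows.
Variable R : realType.

Lemma continuous_row (T : topologicalType) n (g : T -> 'rV[R]_n) :
  (forall i, continuous (fun t => g t 0 i)) -> continuous g.
Proof.
move=> gc t A [P gP PA]; suff: \forall s \near t, forall i, P 0 i (g s 0 i).
  by apply: filterS => s Ps; apply: PA => i j; rewrite ord1.
by apply: filter_forall => i; exact: gc i t _ (gP 0 i).
Qed.

Lemma continuous_butlast n : continuous (@butlast R n).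
Proof.
apply: continuous_row => i z.
under eq_fun do rewrite mxE.
exact: coord_continuous.
Qed.

Lemma continuous_lastc n : continuous (@lastc R n).
Proof.
move=> z; rewrite /lastc.
under eq_fun do rewrite mxE.
exact: coord_continuous.
Qed.

Lemma continuous_snoc n (T : topologicalType) (g : T -> 'rV[R]_n) (k : T -> R) :
  continuous g -> continuous k -> continuous (fun t => snoc (g t) (k t)).
Proof.
move=> gc kc; apply: continuous_row => i t; rewrite /snoc.
case: (split_ordP i) => j ->.
  under eq_fun do rewrite row_mxEl.
  exact: (continuous_comp (gc t) (@coord_continuous _ _ _ _ _ _)).
under eq_fun do rewrite row_mxEr mxE.
exact: kc.
Qed.

Lemma butlast_snoc n (x : 'rV[R]_n) c : butlast (snoc x c) = x.
Proof. exact: row_mxKl. Qed.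

Lemma lastc_snoc n (x : 'rV[R]_n) c : lastc (snoc x c) = c.
Proof. by rewrite /lastc row_mxKr mxE. Qed.

Lemma snocK n (z : 'rV[R]_(n + 1)) : snoc (butlast z) (lastc z) = z.
Proof.
rewrite -[RHS]hsubmxK; congr row_mx; apply/matrixP => i j.
by rewrite !ord1 mxE.
Qed.

Lemma snocZ n a (x : 'rV[R]_n) c : a *: snoc x c = snoc (a *: x) (a * c).
Proof.
rewrite /snoc scale_row_mx; congr row_mx.
by apply/matrixP => i j; rewrite !mxE.
Qed.

Lemma dotp_snoc n (x : 'rV[R]_n) c (z : 'rV[R]_(n + 1)) :
  dotp (snoc x c) z = dotp x (butlast z) + c * lastc z.
Proof.
rewrite /dotp big_split_ord big_ord1 /=; congr (_ + _).
  by apply: eq_bigr => i _; rewrite row_mxEl mxE.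
by rewrite row_mxEr mxE /lastc mxE.
Qed.

Lemma butlastB n (z z' : 'rV[R]_(n + 1)) : butlast (z - z') = butlast z - butlast z'.
Proof. by apply/rowP => i; rewrite !mxE. Qed.

Lemma lastcB n (z z' : 'rV[R]_(n + 1)) : lastc (z - z') = lastc z - lastc z'.
Proof. by rewrite /lastc !mxE. Qed.

Lemma compact_ball n (x : 'rV[R]_n) (r : R) :
  compact (closed_ball_ Num.norm x r).
Proof.
apply: bounded_closed_compact; last exact: closed_closed_ball_.
exists (r + `|x|); split; first exact: num_real.
move=> M /ltW rM y /= xy; apply: le_trans rM; rewrite addrC.
by rewrite -[y](subKr x) (le_trans (ler_normB _ _)) // lerD2l.
Qed.

Lemma closed_epi n (f : 'rV[R]_n -> \bar R) :
  lower_semicontinuous f -> closed (epi f).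
Proof.
move=> lf.
have lF : lower_semicontinuous (fun z => f (butlast z) + (- lastc z)%:E)%E.
  apply: lscD; last by move=> z; exact: (continuousN (@continuous_lastc n z)).
  move=> z a /lf[V zV Vf]; exists (@butlast R n @^-1` V) => [|y /Vf //].
  exact: continuous_butlast zV.
rewrite (_ : epi f = ~` [set z | (0%:E < f (butlast z) + (- lastc z)%:E)%E]).
  by apply: open_closedC; move/lower_semicontinuousP: lF; exact.
apply/seteqP; split => z; rewrite /epi /= EFinN lteBrDr // add0e.
  by move=> fz; apply/negP; rewrite -leNgt.
by move/negP; rewrite -leNgt.
Qed.

End Rows.

(** * Normal cones *)

Section NormalCones.
Variables (R : realType) (n : nat).
Implicit Types (S : set 'rV[R]_n) (x v : 'rV[R]_n).

(** A quadratic bound is stronger than the required [o], since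
    [|d|^2 <= (e / C) |d|] as soon as [|d| <= e / C]. *)
Lemma proximal_normal S x v (C : R) :
  (\forall x' \near x, S x' ->
     dotp v (x' - x) <= C * dotp (x' - x) (x' - x)) ->
  regular_normal S x v.
Proof.
move=> vC e e0; pose C' := `|C| + 1.
have C'0 : 0 < C' by rewrite ltr_pwDr.
have small : \forall x' \near x, dotp (x' - x) (x' - x) < (e / C') ^+ 2.
  have c0 : continuous (fun x' : 'rV[R]_n => x' - x).
    by apply: continuous_sub; [move=> ?; exact: cvg_id|exact: cst_continuous].
  have c := continuous_dotp c0 c0.
  apply: (c x [set d | d < (e / C') ^+ 2]); apply: lt_nbhsl.
  by rewrite subrr dotp0l exprn_gt0 // divr_gt0.
near=> x' => Sx'.
have d_small : enorm (x' - x) <= e / C'.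
  by rewrite enorm_le ?divr_ge0 1?ltW //; near: x'.
apply: (@le_trans _ _ (C * dotp (x' - x) (x' - x))).
  by move: Sx'; near: x'.
rewrite -enorm_sqr expr2 mulrA ler_wpM2r ?enorm_ge0 //.
apply: (@le_trans _ _ (C' * enorm (x' - x))).
  by rewrite ler_wpM2r ?enorm_ge0 // ler_wpDr // ler_norm.
by rewrite mulrC -ler_pdivlMr.
Unshelve. all: by end_near. Qed.

Lemma regular_normalZ S x v (t : R) :
  0 <= t -> regular_normal S x v -> regular_normal S x (t *: v).
Proof.
rewrite le_eqVlt => /orP[/eqP <- _ e e0|t0 nv e e0].
  near=> x' => _; rewrite scale0r dotp0l.
  by rewrite mulr_ge0 ?enorm_ge0 // ltW.
apply: filterS (nv _ (divr_gt0 e0 t0)) => x' + Sx' => /(_ Sx').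
by rewrite dotpZl mulrAC ler_pdivlMr // mulrC.
Unshelve. all: by end_near. Qed.

Lemma limiting_normalZ S x v (t : R) :
  0 <= t -> limiting_normal S x v -> limiting_normal S x (t *: v).
Proof.
move=> t0 [x_ [v_ [xx Sx vv nv]]]; exists x_, (fun k => t *: v_ k); split=> //.
  exact: (@cvgZl_tmp _ _ _ _ _ t v_).
by move=> k; exact: regular_normalZ.
Qed.

(** Reduces the construction of the two sequences in a limiting normal to a
    neighborhood condition, which combines well with cluster points. *)
Lemma limiting_normal_approx S x v :
  (forall U V, nbhs x U -> nbhs v V ->
     exists x' v', [/\ U x', S x', V v' & regular_normal S x' v']) ->
  limiting_normal S x v.
Proof.
move=> approx.
have /choice[q qP] : forall k : nat, exists q : 'rV[R]_n * 'rV[R]_n,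
    [/\ ball x k.+1%:R^-1 q.1, S q.1, ball v k.+1%:R^-1 q.2 &
        regular_normal S q.1 q.2].
  move=> k; have k0 : 0 < k.+1%:R^-1 :> R by rewrite invr_gt0.
  have [x' [v' [? ? ? ?]]] := approx _ _ (nbhsx_ballx x _ k0) (nbhsx_ballx v _ k0).
  by exists (x', v').
exists (fun k => (q k).1), (fun k => (q k).2); split=> [||| k].
- apply/cvg_ballP => e e0; near=> k; have [+ _ _ _] := qP k; apply: le_ball.
  by apply/ltW; near: k; exact: (near_infty_natSinv_lt (PosNum e0)).
- by move=> k; have [] := qP k.
- apply/cvg_ballP => e e0; near=> k; have [_ _ + _] := qP k; apply: le_ball.
  by apply/ltW; near: k; exact: (near_infty_natSinv_lt (PosNum e0)).
- by have [] := qP k.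
Unshelve. all: by end_near. Qed.

End NormalCones.

(** Where a smooth function with a quadratic expansion is minimal relative to a
    set, minus its gradient is normal to the set.  Below, the functions are the
    two partial functions of the penalized problem in [fritz_john]; the term
    [(2 * k) *: (u - y)] of the coupling appears in both gradients, with
    opposite signs. *)
Section PenaltyNormals.
Variables (R : realType) (n : nat).

Lemma epi_penalty_normal (f : 'rV[R]_n -> \bar R) (z : 'rV[R]_(n + 1))
    (y : 'rV[R]_n) (k : R) :
  0 <= k ->
  (\forall z' \near z, epi f z' ->
     lastc z + k * dotp (butlast z - y) (butlast z - y) <=
     lastc z' + k * dotp (butlast z' - y) (butlast z' - y)) ->
  regular_normal (epi f) z (snoc (- ((2 * k) *: (butlast z - y))) (- 1)).
Proof.
move=> k0 zmin; apply: (@proximal_normal _ _ _ _ _ k).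
apply: filterS zmin => z' zmin /zmin ineq.
rewrite dotp_snoc -[in leRHS](snocK (z' - z)).
rewrite dotp_snoc butlast_snoc lastc_snoc butlastB lastcB; move: ineq.
set a := butlast z - y; set d := butlast z' - butlast z.
have -> : butlast z' - y = a + d by rewrite [RHS]addrC addrA subrK.
clearbody a d; rewrite !dotpE (dotpC d a) => ineq.
have := mulr_ge0 k0 (sqr_ge0 (lastc z' - lastc z)).
rewrite expr2; nra.
Qed.

Lemma penalty_normal (S : set 'rV[R]_n) (x y u nu : 'rV[R]_n) (C k : R) :
  (\forall y' \near y, S y' ->
     dotp nu (y - x) + C * dotp (y - x) (y - x) + k * dotp (u - y) (u - y) <=
     dotp nu (y' - x) + C * dotp (y' - x) (y' - x) + k * dotp (u - y') (u - y')) ->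
  regular_normal S y ((2 * k) *: (u - y) - nu - (2 * C) *: (y - x)).
Proof.
move=> ymin; apply: (@proximal_normal _ _ _ _ _ (C + k)).
apply: filterS ymin => y' ymin /ymin.
set a := u - y; set e := y - x; set d := y' - y.
have -> : y' - x = e + d by rewrite [RHS]addrC addrA subrK.
have -> : u - y' = a - d by rewrite opprB addrA subrK.
clearbody a d e; rewrite !dotpE (dotpC d a) (dotpC d e) => ineq.
lra.
Qed.

End PenaltyNormals.

(** * The multiplier rule *)

(** Near a local minimizer [x] of [f + <nu, . - x> + C |. - x|^2] on [S],
    minimize [lastc z + <nu, y - x> + (C + 1) |y - x|^2 + k |butlast z - y|^2]
    over [z] in the epigraph of [f] and [y] in [S].  As [k] grows, the penalty
    forces [butlast z] and [y] together, and the extra [|y - x|^2] makes [x] the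
    only possible limit.  The multiplier [w_k] of the penalty may blow up, so the
    pair [(w_k, 1)] is rescaled by [1 / (1 + |w_k|)]; its limit [(w, l)] has
    [|w| + l = 1] and is therefore nonzero. *)
Lemma fritz_john (R : realType) (n : nat) (f : 'rV[R]_n -> \bar R)
    (S : set 'rV[R]_n) (x nu : 'rV[R]_n) (c C : R) :
  lower_semicontinuous f -> closed S -> S x -> f x = c%:E ->
  (\forall x' \near x, S x' ->
     (c%:E <= f x' + (dotp nu (x' - x) + C * dotp (x' - x) (x' - x))%:E)%E) ->
  exists w l, [/\ 0 <= l, `|w| + l = 1,
    limiting_normal (epi f) (snoc x c) (snoc (- w) (- l)) &
    limiting_normal S x (w - l *: nu)].
Proof.
move=> lf cS Sx fx /nbhs_ballP[r /= r0 xmin].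
pose z0 := snoc x c; pose r' := r / 2.
have r'0 : 0 < r' by rewrite divr_gt0.
pose A := epi f `&` closed_ball_ Num.norm z0 r'.
pose B := S `&` closed_ball_ Num.norm x r'.
have cA : compact A.
  by rewrite /A setIC; apply: compact_closedI; [exact: compact_ball | exact: closed_epi].
have cB : compact B.
  by rewrite /B setIC; apply: compact_closedI => //; exact: compact_ball.
have AB0 : (A `*` B) (z0, x).
  split; split=> //=; rewrite /closed_ball_ /= ?subrr ?normr0 ?ltW //.
  by rewrite /epi /= /z0 butlast_snoc lastc_snoc fx.
(* [G] is the objective without the coupling penalty [k * D]. *)
pose G (q : 'rV[R]_(n + 1) * 'rV[R]_n) :=
  lastc q.1 + dotp nu (q.2 - x) + (C + 1) * dotp (q.2 - x) (q.2 - x).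
pose D (q : 'rV[R]_(n + 1) * 'rV[R]_n) :=
  dotp (butlast q.1 - q.2) (butlast q.1 - q.2).
have c1 : continuous (@fst 'rV[R]_(n + 1) 'rV[R]_n) by move=> q; exact: cvg_fst.
have c2 : continuous (@snd 'rV[R]_(n + 1) 'rV[R]_n) by move=> q; exact: cvg_snd.
have c2x : continuous (fun q : 'rV[R]_(n + 1) * 'rV[R]_n => q.2 - x).
  by apply: continuous_sub c2 _; exact: cst_continuous.
have Dc : continuous D.
  by apply: continuous_dotp; apply: continuous_sub c2;
    exact: (continuous_compose c1 (@continuous_butlast _ _)).
have Gc : continuous G.
  apply: continuous_add; [apply: continuous_add|apply: continuous_mul].
  - exact: (continuous_compose c1 (@continuous_lastc _ _)).
  - by apply: continuous_dotp => // ?; exact: cst_continuous.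
  - by move=> ?; exact: cst_continuous.
  - exact: continuous_dotp.
have cAB := compact_setX cA cB.
(* The minimum of [G] bounds [k * D] along the minimizers, hence [D -> 0]. *)
have [qmin _ Gmin] := compact_argmin cAB (ex_intro _ _ AB0) Gc.
have /choice[q qP] : forall k : nat, exists q, (A `*` B) q /\
    forall q', (A `*` B) q' -> G q + k%:R * D q <= G q' + k%:R * D q'.
  move=> k; have [|q ABq qm] := compact_argmin cAB (ex_intro _ _ AB0)
    (_ : continuous (fun q => G q + k%:R * D q)); last by exists q.
  apply: continuous_add => //; apply: continuous_mul => // ?.
  exact: cst_continuous.
have D_ge0 k : 0 <= k%:R * D (q k) by rewrite mulr_ge0 // dotp_ge0.
have G0 : G (z0, x) = c.
  rewrite /G /= lastc_snoc subrr dotp0l dotp0r; ring.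
have D0 : D (z0, x) = 0.
  by rewrite /D /= butlast_snoc subrr dotp0l.
have le_c k : G (q k) + k%:R * D (q k) <= c.
  by have [_ /(_ _ AB0)] := qP k; rewrite G0 D0 mulr0 addr0.
pose w k := (2 * k%:R) *: (butlast (q k).1 - (q k).2).
pose s k := (1 + `|w k|)^-1.
have s0 k : 0 < s k by rewrite invr_gt0 ltr_pwDl.
pose Q := [set t : ('rV[R]_(n + 1) * 'rV[R]_n) * ('rV[R]_n * R) |
  G t.1 <= c /\ (0 <= t.2.2 /\ `|t.2.1| + t.2.2 = 1)].
pose T := (('rV[R]_(n + 1) * 'rV[R]_n) * ('rV[R]_n * R))%type.
have d1 : continuous (fun t : T => t.1) by move=> t; exact: cvg_fst.
have d2 : continuous (fun t : T => t.2) by move=> t; exact: cvg_snd.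
have d12 := continuous_compose d1 c2.
have d11 := continuous_compose d1 c1.
have d21 : continuous (fun t : T => t.2.1).
  by apply: (continuous_compose d2 (g := fst)) => t; exact: cvg_fst.
have d22 : continuous (fun t : T => t.2.2).
  by apply: (continuous_compose d2 (g := snd)) => t; exact: cvg_snd.
have Q_closed : closed Q.
  apply: closedI; last apply: closedI.
  - exact: (preimage_closed (in1W (continuous_compose d1 Gc)) (@closed_le _ c)).
  - exact: (preimage_closed (in1W d22) (@closed_ge _ 0)).
  - apply: (preimage_closed (in1W (continuous_add _ _)) (@closed_eq _ 1)) => //.
    exact: (continuous_compose d21 (@norm_continuous _ _)).
have cQ : compact (((A `*` B) `*`
    (closed_ball_ Num.norm 0 1 `*` `[0%R, 1%R]%classic)) `&` Q).
  apply: compact_closedI => //; apply: compact_setX => //.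
  by apply: compact_setX; [exact: compact_ball | exact: segment_compact].
(* [Q] records the closed conditions that must pass to the limit. *)
have [k|] := @compact_seq_cluster _ _ (fun k => (q k, (s k *: w k, s k))) cQ.
  have [ABq _] := qP k; have sw : `|s k *: w k| + s k = 1.
    rewrite normrZ gtr0_norm // (_ : _ + _ = s k * (1 + `|w k|)); last by ring.
    by rewrite mulVf // gt_eqF // ltr_pwDl.
  have Gk : G (q k) <= c by apply: le_trans (le_c k); rewrite lerDl.
  split; split=> //=; last by rewrite ltW.
  have sw1 : `|s k *: w k| <= 1 by rewrite -[leRHS]sw lerDl ltW.
  have s1 : s k <= 1 by rewrite -[leRHS]sw lerDr.
  by rewrite /closed_ball_ /= in_itv /= sub0r normrN sw1 s1 ltW.
move=> [[z y] [v l]] [[[[/= ez zz0] [/= Sy yx]] _] [/= Gzy [/= l0 vl]]] clus.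
have zy : butlast z = y.
  apply/eqP; rewrite -subr_eq0; apply/eqP/dotp_eq0/eqP; rewrite eq_le dotp_ge0 andbT.
  rewrite leNgt; apply/negP => Dpos; pose e := D (z, y) / 2.
  have e0 : 0 < e by rewrite divr_gt0.
  have nbD : nbhs (z, y, (v, l)) [set t : T | e < D t.1].
    have De : nbhs (D (z, y)) [set d | e < d].
      by apply: lt_nbhsr; rewrite /e ltr_pdivrMr // mulr2n mulrDr mulr1 ltrDl.
    exact: (continuous_compose d1 Dc) (z, y, (v, l)) _ De.
  have [k Nk /= eD] := clus _ nbD (Num.bound `|(c - G qmin) / e|).
  have := le_c k; have [/Gmin Gk _] := qP k; rewrite leNgt => /negP; apply.
  have : (c - G qmin) / e < k%:R.
    apply: le_lt_trans (ler_norm _) (lt_le_trans (archi_boundP (normr_ge0 _)) _).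
    by rewrite ler_nat.
  rewrite ltr_pdivrMr // => ck.
  have : k%:R * e <= k%:R * D (q k) by rewrite ler_wpM2l // ltW.
  lra.
have Bxy : (c%:E <= f y + (dotp nu (y - x) + C * dotp (y - x) (y - x))%:E)%E.
  apply: xmin => //; rewrite -ball_normE /=; apply: le_lt_trans yx _.
  by rewrite /r' ltr_pdivrMr // mulr2n mulrDr mulr1 ltrDl.
have fyz : (f y <= (lastc z)%:E)%E by rewrite -zy.
have yx0 : y = x.
  apply/eqP; rewrite -subr_eq0; apply/eqP/dotp_eq0/eqP; rewrite eq_le dotp_ge0 andbT.
  have : (c%:E <= (lastc z + (dotp nu (y - x) + C * dotp (y - x) (y - x)))%:E)%E.
    by apply: le_trans Bxy _; rewrite (EFinD (lastc z)); exact: leeD2r.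
  by rewrite lee_fin; move: Gzy; rewrite /G /=; lra.
have zE : z = z0.
  have cz : c <= lastc z by rewrite -lee_fin -fx -yx0.
  rewrite -[z]snocK zy yx0 /z0; congr snoc; apply/eqP; rewrite eq_le cz andbT.
  move: Gzy; rewrite /G /= yx0 subrr dotp0l dotp0r; lra.
have nearz : nbhs (z, y, (v, l)) [set t : T | ball z0 r' t.1.1].
  apply: (d11 (z, y, (v, l))); rewrite /= zE; exact: nbhsx_ballx.
have neary : nbhs (z, y, (v, l)) [set t : T | ball x r' t.1.2].
  apply: (d12 (z, y, (v, l))); rewrite /= yx0; exact: nbhsx_ballx.
(* The minimizers end up in the open balls, so the localization to closed balls
   does not affect their first-order conditions. *)
have near_ball m (a b : 'rV[R]_m) : ball a r' b ->
    \forall b' \near b, closed_ball_ Num.norm a r' b'.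
  move=> ab; have := open_nbhs_nbhs (conj (@ball_open _ _ a r') ab).
  by apply: filterS => b'; rewrite -ball_normE => /ltW.
exists v, l; split=> //.
- apply: limiting_normal_approx => U V zU vV.
  have nbU : nbhs (z, y, (v, l)) [set t : T | U t.1.1].
    by apply: (d11 (z, y, (v, l))); rewrite /= zE.
  have d2s : continuous (fun t : T => snoc (- t.2.1) (- t.2.2)).
    apply: continuous_snoc => t; [exact: (continuousN (d21 t))|].
    exact: (continuousN (d22 t)).
  have nbV : nbhs (z, y, (v, l)) [set t : T | V (snoc (- t.2.1) (- t.2.2))].
    exact: (d2s (z, y, (v, l)) _ vV).
  have [k _ [[/= Uk Vk] zk]] := clus _ (filterI (filterI nbU nbV) nearz) 0%N.
  have [[[epik _] Bk] kmin] := qP k.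
  exists (q k).1, (snoc (- (s k *: w k)) (- s k)); split=> //.
  rewrite (_ : snoc _ _ = s k *: snoc (- w k) (- 1)); last first.
    by rewrite snocZ scalerN mulrN1.
  apply: regular_normalZ; first exact: ltW.
  apply: epi_penalty_normal; first exact: ler0n.
  apply: filterS (near_ball _ _ _ zk) => z' zz' epiz'.
  have := kmin (z', (q k).2) (conj (conj epiz' zz') Bk).
  by rewrite /G /D /=; lra.
- apply: limiting_normal_approx => U V xU vV.
  have nbU : nbhs (z, y, (v, l)) [set t : T | U t.1.2].
    by apply: (d12 (z, y, (v, l))); rewrite /= yx0.
  (* [N] at the index [k] is [s k] times the normal of [penalty_normal]; its last
     term vanishes in the limit, where [y = x]. *)
  pose N (t : T) := t.2.1 - t.2.2 *: (nu + (2 * (C + 1)) *: (t.1.2 - x)).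
  have Nc : continuous N.
    apply: continuous_sub d21 _; apply: continuous_scale d22 _.
    apply: continuous_add; first exact: cst_continuous.
    apply: continuous_scale; first exact: cst_continuous.
    by apply: continuous_sub d12 _; exact: cst_continuous.
  have nbV : nbhs (z, y, (v, l)) [set t : T | V (N t)].
    by apply: (Nc (z, y, (v, l))); rewrite /N /= yx0 subrr scaler0 addr0.
  have [k _ [[/= Uk Vk] yk]] := clus _ (filterI (filterI nbU nbV) neary) 0%N.
  have [[Ak [/= Sk _]] kmin] := qP k.
  exists (q k).2, (N (q k, (s k *: w k, s k))); split=> //.
  rewrite (_ : N _ = s k *: (w k - nu - (2 * (C + 1)) *: ((q k).2 - x))); last first.
    by rewrite /N /= -scalerBr opprD addrA.
  apply: regular_normalZ; first exact: ltW.
  apply: penalty_normal.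
  apply: filterS (near_ball _ _ _ yk) => y' xy' Sy'.
  have := kmin ((q k).1, y') (conj Ak (conj Sy' xy')).
  by rewrite /G /D /=; lra.
Qed.

(** * Tangency points where the function is very negative *)

Section Descent.
Variables (R : realType) (n : nat) (f : 'rV[R]_n -> \bar R) (S : set 'rV[R]_n).
Hypothesis f_gtNy : forall x, (-oo < f x)%E.
Hypothesis f_lsc : lower_semicontinuous f.
Hypothesis S_closed : closed S.

(** A zero multiplier for [f] in [fritz_john] would give the nonzero vector [- w]
    in the intersection that the qualification condition declares trivial;
    otherwise one divides by this multiplier. *)
Lemma local_min_tangency (x : 'rV[R]_n) (c mu C : R) :
  horizon_subdiff f x `&` [set - w | w in limiting_normal S x] = [set 0] ->
  S x -> f x = c%:E ->
  (\forall x' \near x, S x' ->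
     (c%:E <= f x' + (dotp (mu *: x) (x' - x) +
                      C * dotp (x' - x) (x' - x))%:E)%E) ->
  tangency f S x.
Proof.
move=> qc Sx fx /(fritz_john f_lsc S_closed Sx fx)[w [l [l0 wl nf nS]]].
have {l0} [l0|l0] : l = 0 \/ 0 < l.
  by move: l0; rewrite le_eqVlt => /orP[/eqP|]; [left|right].
- exfalso; move: nf nS; rewrite l0 oppr0 scale0r subr0 => nf nS.
  have : (horizon_subdiff f x `&` [set - w | w in limiting_normal S x]) (- w).
    by split; [rewrite /horizon_subdiff /= fx | exists w].
  rewrite qc /= => /eqP; rewrite oppr_eq0 => /eqP w0.
  by move/eqP: wl; rewrite l0 w0 normr0 addr0 eq_sym oner_eq0.
- split; first by split=> //; rewrite /dom /= fx ltry.
  have li0 : 0 <= l^-1 by rewrite invr_ge0 ltW.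
  exists mu, (- (l^-1 *: w)), (l^-1 *: w - mu *: x); split.
  + have := limiting_normalZ li0 nf.
    by rewrite snocZ scalerN mulrN mulVf ?gt_eqF // /subdiff /= fx.
  + have := limiting_normalZ li0 nS.
    by rewrite scalerBr !scalerA mulVf ?gt_eqF // mul1r.
  + by rewrite addrA addNr add0r addNr.
Qed.

Lemma lsc_bounded_below (K : set 'rV[R]_n) :
  compact K -> exists b : R, forall x, K x -> (b%:E <= f x)%E.
Proof.
move=> cK; have [->|/set0P K0] := eqVneq K set0; first by exists 0.
have [x Kx xmin] := lsc_min cK K0 f_lsc.
case fx : (f x) => [b| |].
- by exists b => y /xmin; rewrite fx.
- by exists 0 => y /xmin; rewrite fx leye_eq => /eqP ->; rewrite leey.
- by have := f_gtNy x; rewrite fx ltxx.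
Qed.

Lemma compact_closedI_eball (s : R) : compact (S `&` [set x | dotp x x <= s]).
Proof.
have c : continuous (fun x : 'rV[R]_n => dotp x x).
  by apply: continuous_dotp => x; exact: cvg_id.
have cl : closed [set x : 'rV[R]_n | dotp x x <= s].
  exact: (preimage_closed (in1W c) (@closed_le _ s)).
apply: bounded_closed_compact; last exact: closedI.
exists (Num.sqrt s); split; first exact: num_real.
move=> M sM x [_ /= xs]; apply: (le_trans (normr_le_enorm x)).
by apply: le_trans (ltW sM); rewrite /enorm ler_wsqrtr.
Qed.

(** The linear term is the gradient of the radial penalty; it is colinear to [x].
    The remainder is quadratic because [|x'|^2 - |x|^2] is at most linear in
    [x' - x] near [x]. *)
Lemma quartic_upper_expansion (x x' : 'rV[R]_n) (s kappa : R) :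
  0 <= kappa -> dotp (x' - x) (x' - x) <= 1 ->
  kappa * (dotp x' x' - s) ^+ 2 - kappa * (dotp x x - s) ^+ 2 <=
  dotp ((4 * kappa * (dotp x x - s)) *: x) (x' - x) +
  (2 * kappa * (dotp x x - s) + kappa * (8 * dotp x x + 2)) *
    dotp (x' - x) (x' - x).
Proof.
move=> k0; set d := x' - x.
have -> : x' = x + d by rewrite addrC subrK.
have := cauchy_schwarz x d; have := dotp_ge0 d.
clearbody d; rewrite !dotpE (dotpC d x).
move: (dotp x x) (dotp x d) (dotp d d) => X Y Z Z0 cs Z1.
(* Cauchy-Schwarz gives [Y ^ 2 <= X Z], and [Z ^ 2 <= Z]. *)
have sq : (2 * Y + Z) ^+ 2 <= (8 * X + 2) * Z.
  have := sqr_ge0 (2 * Y - Z); nra.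
have := ler_wpM2l k0 sq; nra.
Qed.

(** The radial penalty vanishes at [x0] and reaches [k] on the outer sphere.  As
    [k] exceeds the oscillation [f x0 - b1] of [f] below [f x0], the minimizer is
    strictly inside; as its value is at most [f x0 < b0], it is outside the ball
    of radius [rho]. *)
Lemma tangency_point_below (qc : QC_infty f S) :
  ~ bounded_below_on f S ->
  forall M T : R, exists2 x, tangency f S x & T < enorm x /\ (f x < M%:E)%E.
Proof.
move=> unb M T; have [r r0 qcr] := qc.
pose rho := Num.max r T.
have [b0 b0P] := lsc_bounded_below (@compact_closedI_eball (rho ^+ 2)).
have [x0 Sx0 fx0] : exists2 x0, S x0 & (f x0 < (Num.min M b0)%:E)%E.
  apply: contrapT => no; apply: unb; exists (Num.min M b0) => x Sx.
  by rewrite leNgt; apply/negP => fx; apply: no; exists x.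
have [c0 fx0E] : exists c0, f x0 = c0%:E.
  case: (f x0) fx0 (f_gtNy x0) => [c0| |] //; first by exists c0.
pose s0 := dotp x0 x0.
have [b1 b1P] := lsc_bounded_below (@compact_closedI_eball (s0 + 1)).
have K0 : (S `&` [set x | dotp x x <= s0 + 1]) x0 by split=> //=; rewrite lerDl.
have b1c0 : b1 <= c0 by rewrite -lee_fin -fx0E; exact: b1P.
pose k := c0 - b1 + 1.
have k0 : 0 <= k by rewrite /k; lra.
have pc : continuous (fun x : 'rV[R]_n => k * (dotp x x - s0) ^+ 2).
  have pc : continuous (fun x : 'rV[R]_n => dotp x x - s0).
    apply: continuous_sub; last by move=> ?; exact: cst_continuous.
    by apply: continuous_dotp => ?; exact: cvg_id.
  apply: continuous_mul; first by move=> ?; exact: cst_continuous.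
  exact: (continuous_mul pc pc).
have [x [Sx /= xs] xmin] := lsc_min (@compact_closedI_eball (s0 + 1))
  (ex_intro _ _ K0) (lscD f_lsc pc).
have Fx0 := xmin _ K0; rewrite fx0E subrr expr0n mulr0 adde0 in Fx0.
have [c fx] : exists c, f x = c%:E.
  by case: (f x) Fx0 (f_gtNy x) => [c| |] //; exists c.
have {}Fx0 : c + k * (dotp x x - s0) ^+ 2 <= c0 by rewrite fx -EFinD lee_fin in Fx0.
have cc0 : c <= c0.
  by have := mulr_ge0 k0 (sqr_ge0 (dotp x x - s0)); lra.
have cM : (c%:E < (Num.min M b0)%:E)%E by rewrite (le_lt_trans _ fx0) // fx0E lee_fin.
have [cM' cb0] : c < M /\ c < b0 by move: cM; rewrite lte_fin lt_min => /andP[].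
have rhox : rho < enorm x.
  rewrite ltNge; apply/negP; rewrite enorm_le ?le_max ?(ltW r0) // => xrho.
  by have := b0P x (conj Sx xrho); rewrite fx lee_fin leNgt cb0.
have b1c : b1 <= c by rewrite -lee_fin -fx; exact: b1P.
have xs1 : dotp x x < s0 + 1.
  rewrite lt_neqAle xs andbT; apply/eqP => xsE.
  by move: Fx0; rewrite xsE (addrAC s0) subrr add0r expr1n mulr1 /k; lra.
have rx : r < enorm x by apply: le_lt_trans rhox; rewrite le_max lexx.
exists x; last by split; [apply: le_lt_trans rhox; rewrite le_max lexx orbT|rewrite fx lte_fin].
apply: (local_min_tangency (mu := 4 * k * (dotp x x - s0))
  (C := 2 * k * (dotp x x - s0) + k * (8 * dotp x x + 2)) _ Sx fx).
  by apply: qcr; split; [split=> //; rewrite /dom /= fx ltry | rewrite /eball /= leNgt rx].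
have near1 : \forall x' \near x, dotp x' x' < s0 + 1.
  have c' : continuous (fun x : 'rV[R]_n => dotp x x).
    by apply: continuous_dotp => y; exact: cvg_id.
  by apply: (c' x [set d | d < s0 + 1]); exact: lt_nbhsl.
have near2 : \forall x' \near x, dotp (x' - x) (x' - x) < 1.
  have c' : continuous (fun x' : 'rV[R]_n => x' - x).
    by apply: continuous_sub; [move=> ?; exact: cvg_id|exact: cst_continuous].
  have c'' := continuous_dotp c' c'; apply: (c'' x [set d | d < 1]).
  apply: lt_nbhsl; by rewrite subrr dotp0l.
apply: filterS2 near1 near2 => x' x's1 dx Sx'.
have := xmin x' (conj Sx' (ltW x's1)).
have := quartic_upper_expansion s0 k0 (ltW dx).
rewrite fx; case: (f x') (f_gtNy x') => [c'| |] // _; last by move=> _ _; rewrite addye // leey.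
rewrite -!EFinD !lee_fin; lra.
Qed.

End Descent.

(** * Asymptotics of functions with a leading term *)

Section LeadingTerm.
Variables (R : realType) (g : R -> R) (a : R) (alpha : rat).
Hypothesis g_lead : leading_term g a alpha.

Lemma leading_term_to_ninfty M :
  0 < alpha -> a < 0 -> \forall t \near +oo, g t < M.
Proof.
move=> al0 a0.
(* This tolerance leaves [g t <= a / 2 * t ^ alpha] eventually. *)
have [_ /(_ (- a / 2))] := g_lead.
case=> [|t0 [_ gt]]; first by rewrite divr_gt0 // oppr_gt0.
pose B := `|2 * M / a| + 1.
have B0 : 0 < B by rewrite ltr_pwDr.
near=> t; have := gt t; have t_gt0 : 0 < t by near: t; exact: nbhs_pinfty_gt.
have Bt : B <= t `^ ratr alpha.
  have tB : B `^ (ratr alpha)^-1 <= t by near: t; exact: nbhs_pinfty_ge.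
  have al0' : 0 < ratr alpha :> R by rewrite ltr0q.
  rewrite -[B]powRr1 ?(ltW B0) // -(mulVf (lt0r_neq0 al0')) powRrM.
  by apply: (ge0_ler_powR (ltW al0') _ _ tB); rewrite ?nnegrE ?powR_ge0 ?ltW.
have t0t : t0 < t by near: t; apply: nbhs_pinfty_gt; exact: num_real.
move=> /(_ t0t); rewrite (ger0_norm (powR_ge0 _ _)) ler_norml => /andP[_].
have MB : 2 * M / a < B by rewrite /B (le_lt_trans (ler_norm _)) // ltrDl.
have aM : a * B < 2 * M.
  by rewrite -(ltr_nM2l a0) mulrCA divff ?lt_eqF // mulr1 in MB.
have := ler_wnM2l (ltW a0) Bt; lra.
Unshelve. all: by end_near. Qed.

(** Either [g] is eventually nonnegative, or its leading term is bounded since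
    [t ^ alpha <= 1] for [alpha <= 0]. *)
Lemma leading_term_bounded_below :
  (0 < alpha -> 0 < a) -> exists M, \forall t \near +oo, M <= g t.
Proof.
move=> apos; have [a0 lead] := g_lead; have na0 : 0 < `|a| by rewrite normr_gt0.
have [al0|al0] := ltP 0 alpha.
  have {apos} a_gt0 := apos al0.
  exists 0; apply: filterS (lead _ na0) => t.
  by rewrite (ger0_norm (powR_ge0 _ _)) (gtr0_norm a_gt0) ler_norml => /andP[? ?]; lra.
exists (- (2 * `|a|)); near=> t.
have t1 : 1 <= t by near: t; exact: nbhs_pinfty_ge.
have p1 : t `^ ratr alpha <= 1.
  by rewrite -[leRHS](powRr0 t); apply: ler_powR; rewrite // lerq0.
have := powR_ge0 t (ratr alpha).
have : `|g t - a * t `^ ratr alpha| <= `|a| * `|t `^ ratr alpha|.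
  by near: t; exact: lead.
rewrite (ger0_norm (powR_ge0 _ _)) ler_norml => /andP[? ?].
have := ler_norm (- a); rewrite normrN; nra.
Unshelve. all: by end_near. Qed.

End LeadingTerm.

(** * The boundedness criterion *)

Theorem theorem4p2 (R : realType) (n : nat)
    (f : 'rV[R]_n -> \bar R) (S : set 'rV[R]_n)
    (f_gtNy : forall x, (-oo < f x)%E)
    (f_lsc : lower_semicontinuous f)
    (f_semialg : semialgebraic_efun f)
    (S_closed : closed S)
    (S_semialg : semialgebraic S)
    (domS_neq0 : dom f `&` S !=set0)
    (domS_unbounded : ~ bounded_set (dom f `&` S))
    (qc : QC_infty f S)
    (l : nat) (C : 'I_l -> set 'rV[R]_n)
    (C_part : admissible_partition f S C)
    (m : nat) (r0 : R) (F : 'I_l -> set 'rV[R]_m)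
    (h : 'rV[R]_(m + 1) -> 'rV[R]_n)
    (h_hardt : hardt_trivialization (tangency f S) C r0 F h)
    (p : nat) (E : 'I_p -> set 'rV[R]_m)
    (E_comp : enumerates_components F E) :
  \forall r \near +oo%R,
    forall (fk : 'I_p -> R -> R) (a : 'I_p -> R) (alpha : 'I_p -> rat),
      radial_values f (piece h E r) r fk ->
      (forall k, nonconstant fk r k -> leading_term (fk k) (a k) (alpha k)) ->
      (bounded_below_on f S <->
       forall k, nonconstant fk r k -> 0 < alpha k -> 0 < a k).
Proof.
have [r0_gt0 _ [_ [[h_fun _ h_surj] _ _]] h_norm _] := h_hardt.
have [E_fun _ E_surj] := E_comp.
near=> r => fk a alpha radial lead.
have r0r : r0 <= r by near: r; apply: nbhs_pinfty_ge; exact: num_real.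
split=> [[M fM] k kN al0|a_pos].
- have [a0 _] := lead _ kN; rewrite lt_neqAle eq_sym a0 leNgt; apply/negP => a_lt0.
  have [t [/= ft rt]] : exists t, fk k t < M /\ r < t.
    apply: (@filter_ex _ (nbhs +oo%R)); apply: filterI.
      exact: leading_term_to_ninfty (lead _ kN) M al0 a_lt0.
    by apply: nbhs_pinfty_gt; exact: num_real.
  have [i [y Fy Ek]] := E_fun k I.
  have Dz : cylinder (\bigcup_i F i) r0 (snoc y t).
    rewrite /cylinder /= butlast_snoc lastc_snoc; split; first by exists i.
    exact: le_lt_trans rt.
  have [[[_ Sx] _] _] := h_fun _ Dz.
  have := fM _ Sx; rewrite (radial k t rt) ?lee_fin ?leNgt ?ft //.
  split; last by rewrite /esphere /= h_norm // lastc_snoc.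
  exists (snoc y t) => //; rewrite /cylinder /= butlast_snoc lastc_snoc Ek; split=> //.
  exact: connected_component_refl.
- apply: contrapT => unb.
  have /choice[M MP] : forall k, exists M, \forall t \near +oo, M <= fk k t.
    move=> k; have [kN|/contrapT[c fc]] := pselect (nonconstant fk r k).
      by apply: leading_term_bounded_below (lead _ kN) _; exact: a_pos.
    exists c; exists r; split; first exact: num_real.
    by move=> t /fc ->.
  have [T [_ TP]] : \forall t \near +oo, forall k, M k <= fk k t.
    exact: filter_forall.
  have [x Gx [xT fx]] := tangency_point_below f_gtNy f_lsc S_closed qc unb
    (- \sum_k `|M k|) (Num.max T r).
  move: xT; rewrite gt_max => /andP[Tx rx].
  have [|z [[i _ Fz] r0z] hz] := h_surj x.
    by split=> //; rewrite /eball /= => /(lt_le_trans rx); rewrite ltNge r0r.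
  have [|k _ Ek] := E_surj (connected_component (F i) (butlast z)).
    by exists i; exists (butlast z).
  have zx : lastc z = enorm x.
    by rewrite -hz h_norm //; split=> //; exists i.
  move: fx; rewrite (radial k _ rx); last first.
    split=> //; exists z => //; split; last by rewrite zx.
    by rewrite Ek; exact: connected_component_refl.
  rewrite lte_fin ltNge => /negP; apply.
  (* The level [- \sum_k `|M k|] is below every [M k]. *)
  apply: le_trans (TP _ Tx k); rewrite lerNl.
  apply: (le_trans (ler_norm _)); rewrite normrN (bigD1 k) //= lerDl.
  exact: sumr_ge0.
Unshelve. all: by end_near. Qed.
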